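(* Let $\mathbf{D}$ be a locally small dagger rig category satisfying axioms (A1)–(A10) listed in the context, and let $\mathcal{R}_+$ be its partially ordered strict semifield of positive scalars. Then every increasing sequence in $\mathcal{R}_+$ that has an upper bound in $\mathcal{R}_+$ has a supremum in $\mathcal{R}_+$, and these suprema are preserved by every map of the form $a+(-)\colon\mathcal{R}_+\to\mathcal{R}_+$ with $a\in\mathcal{R}_+$; that is, for each bounded increasing sequence $(b_n)$ in $\mathcal{R}_+$, the supremum of $(a+b_n)$ exists and $\sup_n(a+b_n)=a+\sup_n b_n$.
   Context: Dagger categories. A dagger on a category is a contravariant endofunctor $(-)^\dagger$ with $X^\dagger=X$ and $f^{\dagger\dagger}=f$. A morphism $f$ is a dagger monomorphism if $f^\dagger f=1$, a dagger epimorphism if $ff^\dagger=1$, a dagger isomorphism if both. A dagger symmetric monoidal category is a symmetric monoidal category with a dagger whose monoidal product is a dagger functor (preserves $\dagger$) and whose symmetry, associator and unitors are dagger isomorphisms. A dagger rig category is a dagger category with dagger symmetric monoidal structures $(\otimes,I)$ and $(\oplus,O)$ and natural dagger isomorphisms $A\otimes(X\oplus Y)\to(A\otimes X)\oplus(A\otimes Y)$, $(X\oplus Y)\otimes A\to(X\otimes A)\oplus(Y\otimes A)$, $X\otimes O\to O$, $O\otimes X\to O$, satisfying Laplaza's coherence conditions for rig (symmetric bimonoidal) categories, which amount to the following. Write $\alpha,\lambda,\rho,\sigma$ for the associator $(A\otimes B)\otimes C\to A\otimes(B\otimes C)$, left unitor $I\otimes A\to A$, right unitor $A\otimes I\to A$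 and symmetry of $\otimes$, write $\alpha',\lambda',\rho',\sigma'$ for those of $\oplus$, write $\delta_{A,X,Y},\varepsilon_{X,Y,A},\xi_X,\zeta_X$ for the four isomorphisms just listed, in that order, and write $\tau_{W,X,Y,Z}\colon(W\oplus X)\oplus(Y\oplus Z)\to(W\oplus Y)\oplus(X\oplus Z)$ for the canonical interchange isomorphism built from $\alpha'$ and $\sigma'$. Then, for all objects $A,B,C,D$ (abbreviating $A\otimes B$ to $AB$): $\sigma'_{AB,AC}\,\delta_{A,B,C}=\delta_{A,C,B}(1_A\otimes\sigma'_{B,C})$; $(\sigma_{A,C}\oplus\sigma_{B,C})\varepsilon_{A,B,C}=\delta_{C,A,B}\,\sigma_{A\oplus B,C}$; $\alpha'_{AB,AC,AD}(\delta_{A,B,C}\oplus1_{AD})\delta_{A,B\oplus C,D}=(1_{AB}\oplus\delta_{A,C,D})\delta_{A,B,C\oplus D}(1_A\otimes\alpha'_{B,C,D})$; $\delta_{A,BC,BD}(1_A\otimes\delta_{B,C,D})\alpha_{A,B,C\oplus D}=(\alpha_{A,B,C}\oplus\alpha_{A,B,D})\delta_{AB,C,D}$; $\tau_{AC,BC,AD,BD}(\varepsilon_{A,B,C}\oplus\varepsilon_{A,B,D})\delta_{A\oplus B,C,D}=(\delta_{A,C,D}\oplus\delta_{B,C,D})\varepsilon_{A,B,C\oplus D}$; $\zeta_O=\xi_O$; $\zeta_{A\oplus B}=\lambda'_O(\zeta_A\oplus\zeta_B)\delta_{O,A,B}$; $\zeta_I=\rho_O$; $\xi_A\,\sigma_{O,A}=\zeta_A$;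 $\zeta_{AB}\,\alpha_{O,A,B}=\zeta_B(\zeta_A\otimes1_B)$; $\lambda'_{AB}(\xi_A\oplus1_{AB})\delta_{A,O,B}=1_A\otimes\lambda'_B$; $(\lambda_A\oplus\lambda_B)\delta_{I,A,B}=\lambda_{A\oplus B}$ (the remaining conditions on Laplaza's list follow from these). Axioms. (A1) $O$ is terminal (hence a zero object; write $0$ for zero morphisms, $i_1\colon X\cong X\oplus O\xrightarrow{1\oplus0}X\oplus Y$, $i_2\colon Y\cong O\oplus Y\xrightarrow{0\oplus1}X\oplus Y$, $p_k=i_k^\dagger$). (A2) $i_1,i_2$ are jointly epic. (A3) There is $d\colon I\to I\oplus I$ with $i_1^\dagger d\ne0\ne i_2^\dagger d$. (A4) Exactly two subobjects of $I$ have a dagger monic representative. (A5) If $f,g\colon X\otimes Y\to Z$ satisfy $f(x\otimes y)=g(x\otimes y)$ for all $x\colon I\to X$, $y\colon I\to Y$, then $f=g$. (A6) Every parallel pair has an equaliser that is a dagger monomorphism. (A7) Every dagger monomorphism is a kernel. (A8) For all epimorphisms $x\colon A\to X$, $y\colon A\to Y$: $x^\dagger x=y^\dagger y$ if and only if $y=fx$ for some isomorphism $f\colon X\to Y$. (A9) Every bounded sequential diagram has a colimit, where a sequential diagram is one generated by a sequence $X_1\xrightarrow{f_1}X_2\xrightarrow{f_2}\cdots$, and it is bounded if it has a cocone of monomorphisms. (A10) Every object $X$ is dagger finite: each $f\colon X\to X$ with $f^\dagger f=1$ satisfies $ff^\dagger=1$. The localisation $U\colon\mathbf{D}\to\mathbf{C}$.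 For $a\colon I\to I$ and $f\colon X\to Y$ in $\mathbf{D}$, let $a\cdot f=(X\cong I\otimes X\xrightarrow{a\otimes f}I\otimes Y\cong Y)$. The category $\mathbf{C}$ has the same objects as $\mathbf{D}$; its morphisms $X\to Y$ are equivalence classes $f/a$ of pairs $(f,a)$ with $f\colon X\to Y$ and $0\ne a\colon I\to I$ in $\mathbf{D}$, where $(f,a)\simeq(g,b)$ iff $b\cdot f=a\cdot g$; composition is $(g/b)(f/a)=(gf)/(ba)$; the dagger is $(f/a)^\dagger=f^\dagger/a^\dagger$; and $\frac fa\otimes\frac gb=\frac{f\otimes g}{ab}$, $\frac fa\oplus\frac gb=\frac{b\cdot f\oplus a\cdot g}{ab}$. $U$ is the identity on objects and $f\mapsto f/1$ on morphisms; it is faithful and $\mathbf{D}$ is identified with its image. In $\mathbf{C}$, $O$ is a zero object and $X\oplus Y$ with $i_1,i_2,p_1,p_2$ is a dagger biproduct, so hom-sets carry an addition, and $\mathcal{C}=\mathbf{C}(I,I)$ is an involutive field of characteristic zero (multiplication is composition, involution is $\dagger$). Positive scalars. The comma category $I\downarrow U$ has as objects pairs $(X,x)$ with $x\colon I\to X$ in $\mathbf{C}$, and as morphisms $(X,x)\to(Y,y)$ the morphisms $f\colon X\to Y$ of $\mathbf{D}$ with $y=fx$ in $\mathbf{C}$. Let $\mathcal{R}_+=\{x^\dagger x : (X,x)\in I\downarrow U\}\subseteq\mathcal{C}$, with the addition and multiplication of $\mathcal{C}$. It is partially ordered by: $x^\dagger x\ge y^\dagger y$ iff there is a morphism $(X,x)\to(Y,y)$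 in $I\downarrow U$ (this is well defined, independently of the chosen representatives, and makes $\mathcal{R}_+$ a partially ordered strict semifield, i.e. a semifield that is not a field, with a partial order such that addition and multiplication are monotonic and $1\ge0$). ''Increasing'' includes equality. *)

(* Defs.v *)
From HB Require Import structures.
Set Warnings "-notation-overridden".
From mathcomp Require Import all_boot.
From mathcomp Require Import boolp classical_sets.

Set Implicit Arguments.
Unset Strict Implicit.
Unset Printing Implicit Defensive.

Local Open Scope quotient_scope.

Declare Scope cat_scope.
Delimit Scope cat_scope with cat.
Local Open Scope cat_scope.

(* Local smallness is built in: [hom X Y] is a type in a universe that does not
   depend on the one of [ob]. Equality of morphisms is Leibniz equality. *)
Record category := Category {
  ob :> Type;
  hom : ob -> ob -> Type;
  idm : forall X, hom X X;
  comp : forall X Y Z, hom Y Z -> hom X Y -> hom X Z;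
  comp1m : forall X Y (f : hom X Y), comp (idm Y) f = f;
  compm1 : forall X Y (f : hom X Y), comp f (idm X) = f;
  compA : forall W X Y Z (h : hom Y Z) (g : hom X Y) (f : hom W X),
    comp h (comp g f) = comp (comp h g) f }.

Arguments hom {_} _ _.
Arguments idm {_} _.
Arguments comp {_ X Y Z} _ _.
Notation "g ∘ f" := (comp g f) (at level 40, left associativity) : cat_scope.

Record dagger_category := DaggerCategory {
  dcat :> category;
  dag : forall X Y : dcat, hom X Y -> hom Y X;
  dag1 : forall X, dag (idm X) = idm X;
  dagM : forall X Y Z (g : hom Y Z) (f : hom X Y), dag (g ∘ f) = dag f ∘ dag g;
  dagK : forall X Y (f : hom X Y), dag (dag f) = f }.

Arguments dag {_ X Y} _.
Notation "f ^†" := (dag f) (at level 2, left associativity, format "f ^†") :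
  cat_scope.

Section MorphismClasses.
Context {C : category}.

Definition monic (X Y : C) (f : hom X Y) : Prop :=
  forall W (g h : hom W X), f ∘ g = f ∘ h -> g = h.

Definition epic (X Y : C) (f : hom X Y) : Prop :=
  forall Z (g h : hom Y Z), g ∘ f = h ∘ f -> g = h.

Definition is_iso (X Y : C) (f : hom X Y) : Prop :=
  exists g : hom Y X, g ∘ f = idm X /\ f ∘ g = idm Y.

Definition terminal (T : C) : Prop :=
  forall X : C, exists f : hom X T, forall g : hom X T, g = f.

Definition is_equaliser (X Y E : C) (f g : hom X Y) (e : hom E X) : Prop :=
  f ∘ e = g ∘ e /\
  forall W (h : hom W X), f ∘ h = g ∘ h ->
    exists! u : hom W E, e ∘ u = h.

(* equality of the subobjects represented by two monomorphisms *)
Definition same_subobject (S T X : C) (m : hom S X) (n : hom T X) : Prop :=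
  exists u : hom S T, is_iso u /\ m = n ∘ u.

(* A sequential diagram X 0 --> X 1 --> X 2 --> ... is given by f. *)
Definition is_cocone (X : nat -> C) (f : forall n, hom (X n) (X n.+1))
    (L : C) (c : forall n, hom (X n) L) : Prop :=
  forall n, c n.+1 ∘ f n = c n.

Definition is_colimit (X : nat -> C) (f : forall n, hom (X n) (X n.+1))
    (L : C) (c : forall n, hom (X n) L) : Prop :=
  is_cocone f c /\
  forall (M : C) (k : forall n, hom (X n) M), is_cocone f k ->
    exists! u : hom L M, forall n, u ∘ c n = k n.

Definition bounded_sequence (X : nat -> C)
    (f : forall n, hom (X n) (X n.+1)) : Prop :=
  exists (L : C) (c : forall n, hom (X n) L),
    is_cocone f c /\ forall n, monic (c n).

End MorphismClasses.

Section DaggerClasses.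
Context {D : dagger_category}.

Definition dagger_monic (X Y : D) (f : hom X Y) : Prop := f^† ∘ f = idm X.
Definition dagger_epic (X Y : D) (f : hom X Y) : Prop := f ∘ f^† = idm Y.
Definition dagger_iso (X Y : D) (f : hom X Y) : Prop :=
  dagger_monic f /\ dagger_epic f.

End DaggerClasses.

Record monoidal_data (D : dagger_category) := MonoidalData {
  mob : D -> D -> D;
  mhom : forall X X' Y Y', hom X X' -> hom Y Y' -> hom (mob X Y) (mob X' Y');
  munit : D;
  massoc : forall A B C, hom (mob (mob A B) C) (mob A (mob B C));
  mlun : forall A, hom (mob munit A) A;
  mrun : forall A, hom (mob A munit) A;
  msym : forall A B, hom (mob A B) (mob B A) }.

Arguments mhom {_} _ {X X' Y Y'} _ _.

Section MonoidalLaws.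
Context {D : dagger_category} (M : monoidal_data D).
Local Notation "A ⊠ B" := (mob M A B) (at level 40, left associativity).
Local Notation "f ⊠₁ g" := (mhom M f g) (at level 40, left associativity).
Local Notation J := (munit M).
Local Notation "1_ A" := (idm A) (at level 8, A at level 2, format "1_ A").
Local Notation a_ := (massoc M).
Local Notation l_ := (mlun M).
Local Notation r_ := (mrun M).
Local Notation s_ := (msym M).

(* Following Mac Lane, [unitors_unit] and [msym_unit] are part of the
   definition, although they follow from the other laws. *)
Record dagger_symmetric_monoidal : Prop := DaggerSymmetricMonoidal {
  mhom1 : forall A B, 1_A ⊠₁ 1_B = 1_(A ⊠ B);
  mhomM : forall A A' A'' B B' B'' (f' : hom A' A'') (f : hom A A')
      (g' : hom B' B'') (g : hom B B'),
    (f' ∘ f) ⊠₁ (g' ∘ g) = (f' ⊠₁ g') ∘ (f ⊠₁ g);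
  mhom_dag : forall A A' B B' (f : hom A A') (g : hom B B'),
    (f ⊠₁ g)^† = f^† ⊠₁ g^†;
  massoc_iso : forall A B C, dagger_iso (a_ A B C);
  mlun_iso : forall A, dagger_iso (l_ A);
  mrun_iso : forall A, dagger_iso (r_ A);
  msym_iso : forall A B, dagger_iso (s_ A B);
  massoc_nat : forall A A' B B' C C'
      (f : hom A A') (g : hom B B') (h : hom C C'),
    a_ A' B' C' ∘ ((f ⊠₁ g) ⊠₁ h) = (f ⊠₁ (g ⊠₁ h)) ∘ a_ A B C;
  mlun_nat : forall A A' (f : hom A A'), l_ A' ∘ (1_J ⊠₁ f) = f ∘ l_ A;
  mrun_nat : forall A A' (f : hom A A'), r_ A' ∘ (f ⊠₁ 1_J) = f ∘ r_ A;
  msym_nat : forall A A' B B' (f : hom A A') (g : hom B B'),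
    s_ A' B' ∘ (f ⊠₁ g) = (g ⊠₁ f) ∘ s_ A B;
  pentagon : forall A B C E,
    a_ A B (C ⊠ E) ∘ a_ (A ⊠ B) C E =
    (1_A ⊠₁ a_ B C E) ∘ a_ A (B ⊠ C) E ∘ (a_ A B C ⊠₁ 1_E);
  triangle : forall A B, (1_A ⊠₁ l_ B) ∘ a_ A J B = r_ A ⊠₁ 1_B;
  unitors_unit : l_ J = r_ J;
  msymK : forall A B, s_ B A ∘ s_ A B = 1_(A ⊠ B);
  msym_unit : forall A, l_ A ∘ s_ A J = r_ A;
  hexagon : forall A B C,
    a_ B C A ∘ s_ A (B ⊠ C) ∘ a_ A B C =
    (1_B ⊠₁ s_ A C) ∘ a_ B A C ∘ (s_ A B ⊠₁ 1_C) }.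

(* the canonical isomorphism (W + X) + (Y + Z) --> (W + Y) + (X + Z) *)
Definition interchange (W X Y Z : D) :
    hom ((W ⊠ X) ⊠ (Y ⊠ Z)) ((W ⊠ Y) ⊠ (X ⊠ Z)) :=
  (a_ W Y (X ⊠ Z))^†
  ∘ (1_W ⊠₁ (a_ Y X Z ∘ (s_ X Y ⊠₁ 1_Z) ∘ (a_ X Y Z)^†))
  ∘ a_ W X (Y ⊠ Z).

End MonoidalLaws.

Record rig_data (D : dagger_category) := RigData {
  rtimes : monoidal_data D;
  rplus : monoidal_data D;
  distl : forall A X Y : D,
    hom (mob rtimes A (mob rplus X Y))
        (mob rplus (mob rtimes A X) (mob rtimes A Y));
  distr : forall X Y A : D,
    hom (mob rtimes (mob rplus X Y) A)
        (mob rplus (mob rtimes X A) (mob rtimes Y A));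
  absr : forall X : D, hom (mob rtimes X (munit rplus)) (munit rplus);
  absl : forall X : D, hom (mob rtimes (munit rplus) X) (munit rplus) }.

Section RigLaws.
Context {D : dagger_category} (R : rig_data D).
Local Notation "A ⊗ B" := (mob (rtimes R) A B) (at level 40, left associativity).
Local Notation "A ⊕ B" := (mob (rplus R) A B) (at level 50, left associativity).
Local Notation "f ⊗₁ g" := (mhom (rtimes R) f g)
  (at level 40, left associativity).
Local Notation "f ⊕₁ g" := (mhom (rplus R) f g)
  (at level 50, left associativity).
Local Notation "1_ A" := (idm A) (at level 8, A at level 2, format "1_ A").
Local Notation I := (munit (rtimes R)).
Local Notation O := (munit (rplus R)).
Local Notation α := (massoc (rtimes R)).
Local Notation λ := (mlun (rtimes R)).
Local Notation ρ := (mrun (rtimes R)).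
Local Notation σ := (msym (rtimes R)).
Local Notation α' := (massoc (rplus R)).
Local Notation λ' := (mlun (rplus R)).
Local Notation σ' := (msym (rplus R)).
Local Notation δ := (distl R).
Local Notation ε := (distr R).
Local Notation ξ := (absr R).
Local Notation ζ := (absl R).
Local Notation τ := (interchange (rplus R)).

Record dagger_rig : Prop := DaggerRig {
  rtimes_smc : dagger_symmetric_monoidal (rtimes R);
  rplus_smc : dagger_symmetric_monoidal (rplus R);
  distl_iso : forall A X Y, dagger_iso (δ A X Y);
  distr_iso : forall X Y A, dagger_iso (ε X Y A);
  absr_iso : forall X, dagger_iso (ξ X);
  absl_iso : forall X, dagger_iso (ζ X);
  distl_nat : forall A A' X X' Y Y'
      (f : hom A A') (g : hom X X') (h : hom Y Y'),
    δ A' X' Y' ∘ (f ⊗₁ (g ⊕₁ h)) = (f ⊗₁ g ⊕₁ f ⊗₁ h) ∘ δ A X Y;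
  distr_nat : forall A A' X X' Y Y'
      (f : hom A A') (g : hom X X') (h : hom Y Y'),
    ε X' Y' A' ∘ ((g ⊕₁ h) ⊗₁ f) = (g ⊗₁ f ⊕₁ h ⊗₁ f) ∘ ε X Y A;
  absr_nat : forall X X' (f : hom X X'), ξ X' ∘ (f ⊗₁ 1_O) = ξ X;
  absl_nat : forall X X' (f : hom X X'), ζ X' ∘ (1_O ⊗₁ f) = ζ X;
  distl_sym : forall A B C,
    σ' (A ⊗ B) (A ⊗ C) ∘ δ A B C = δ A C B ∘ (1_A ⊗₁ σ' B C);
  distr_distl : forall A B C,
    (σ A C ⊕₁ σ B C) ∘ ε A B C = δ C A B ∘ σ (A ⊕ B) C;
  distl_assoc_plus : forall A B C E,
    α' (A ⊗ B) (A ⊗ C) (A ⊗ E) ∘ (δ A B C ⊕₁ 1_(A ⊗ E)) ∘ δ A (B ⊕ C) E =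
    (1_(A ⊗ B) ⊕₁ δ A C E) ∘ δ A B (C ⊕ E) ∘ (1_A ⊗₁ α' B C E);
  distl_assoc_times : forall A B C E,
    δ A (B ⊗ C) (B ⊗ E) ∘ (1_A ⊗₁ δ B C E) ∘ α A B (C ⊕ E) =
    (α A B C ⊕₁ α A B E) ∘ δ (A ⊗ B) C E;
  dist_interchange : forall A B C E,
    τ (A ⊗ C) (B ⊗ C) (A ⊗ E) (B ⊗ E) ∘ (ε A B C ⊕₁ ε A B E) ∘ δ (A ⊕ B) C E =
    (δ A C E ⊕₁ δ B C E) ∘ ε A B (C ⊕ E);
  abs_zero : ζ O = ξ O;
  absl_plus : forall A B, ζ (A ⊕ B) = λ' O ∘ (ζ A ⊕₁ ζ B) ∘ δ O A B;
  absl_unit : ζ I = ρ O;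
  absr_sym : forall A, ξ A ∘ σ O A = ζ A;
  absl_times : forall A B, ζ (A ⊗ B) ∘ α O A B = ζ B ∘ (ζ A ⊗₁ 1_B);
  distl_zero : forall A B,
    λ' (A ⊗ B) ∘ (ξ A ⊕₁ 1_(A ⊗ B)) ∘ δ A O B = 1_A ⊗₁ λ' B;
  distl_unit : forall A B, (λ A ⊕₁ λ B) ∘ δ I A B = λ (A ⊕ B) }.

End RigLaws.

Record dagger_rig_category := DaggerRigCategory {
  rcat :> dagger_category;
  rdata : rig_data rcat;
  rlaws : dagger_rig rdata }.

Definition tens (D : dagger_rig_category) : D -> D -> D := mob (rtimes (rdata D)).
Definition oplus (D : dagger_rig_category) : D -> D -> D := mob (rplus (rdata D)).
Definition tens1 (D : dagger_rig_category) (X X' Y Y' : D)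
  (f : hom X X') (g : hom Y Y') : hom (tens X Y) (tens X' Y') :=
  mhom (rtimes (rdata D)) f g.
Definition oplus1 (D : dagger_rig_category) (X X' Y Y' : D)
  (f : hom X X') (g : hom Y Y') : hom (oplus X Y) (oplus X' Y') :=
  mhom (rplus (rdata D)) f g.
Definition one_ob (D : dagger_rig_category) : D := munit (rtimes (rdata D)).
Definition zero_ob (D : dagger_rig_category) : D := munit (rplus (rdata D)).

Arguments one_ob {D}.
Arguments zero_ob {D}.
Notation "A ⊗ B" := (tens A B) (at level 40, left associativity) : cat_scope.
Notation "A ⊕ B" := (oplus A B) (at level 50, left associativity) : cat_scope.
Notation "f ⊗₁ g" := (tens1 f g) (at level 40, left associativity) : cat_scope.
Notation "f ⊕₁ g" := (oplus1 f g) (at level 50, left associativity) : cat_scope.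

Section ZeroObject.
Context {D : dagger_rig_category} (tO : terminal (@zero_ob D)).

Definition bang (X : D) : hom X zero_ob := sval (cid (tO X)).

(* the dagger makes the terminal object O a zero object *)
Definition zero_mor (X Y : D) : hom X Y := (bang Y)^† ∘ bang X.

Definition binj1 (X Y : D) : hom X (X ⊕ Y) :=
  (idm X ⊕₁ zero_mor zero_ob Y) ∘ (mrun (rplus (rdata D)) X)^†.
Definition binj2 (X Y : D) : hom Y (X ⊕ Y) :=
  (zero_mor zero_ob X ⊕₁ idm Y) ∘ (mlun (rplus (rdata D)) Y)^†.
Definition bproj1 (X Y : D) : hom (X ⊕ Y) X := (binj1 X Y)^†.
Definition bproj2 (X Y : D) : hom (X ⊕ Y) Y := (binj2 X Y)^†.

End ZeroObject.

Record contraction_axioms (D : dagger_rig_category) : Prop :=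
    ContractionAxioms {
  ax_terminal : terminal (@zero_ob D);
  ax_jointly_epic : forall (X Y Z : D) (f g : hom (X ⊕ Y) Z),
    f ∘ binj1 ax_terminal X Y = g ∘ binj1 ax_terminal X Y ->
    f ∘ binj2 ax_terminal X Y = g ∘ binj2 ax_terminal X Y -> f = g;
  ax_superposition : exists d : hom (@one_ob D) (one_ob ⊕ one_ob),
    (binj1 ax_terminal one_ob one_ob)^† ∘ d <> zero_mor ax_terminal _ _ /\
    (binj2 ax_terminal one_ob one_ob)^† ∘ d <> zero_mor ax_terminal _ _;
  (* a subobject with a dagger monic representative is given by that
     representative *)
  ax_two_subobjects :
    exists (S1 S2 : D) (m1 : hom S1 one_ob) (m2 : hom S2 one_ob),
      [/\ dagger_monic m1, dagger_monic m2, ~ same_subobject m1 m2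
        & forall (S : D) (m : hom S one_ob), dagger_monic m ->
            same_subobject m m1 \/ same_subobject m m2];
  ax_separator : forall (X Y Z : D) (f g : hom (X ⊗ Y) Z),
    (forall (x : hom one_ob X) (y : hom one_ob Y),
        f ∘ (x ⊗₁ y) = g ∘ (x ⊗₁ y)) -> f = g;
  ax_dagger_equaliser : forall (X Y : D) (f g : hom X Y),
    exists (E : D) (e : hom E X), dagger_monic e /\ is_equaliser f g e;
  ax_dagger_kernel : forall (S X : D) (m : hom S X), dagger_monic m ->
    exists (Y : D) (f : hom X Y), is_equaliser f (zero_mor ax_terminal X Y) m;
  ax_positive : forall (A X Y : D) (x : hom A X) (y : hom A Y),
    epic x -> epic y ->
    (x^† ∘ x = y^† ∘ y <-> exists f : hom X Y, is_iso f /\ y = f ∘ x);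
  ax_bounded_colimit : forall (X : nat -> D) (f : forall n, hom (X n) (X n.+1)),
    bounded_sequence f ->
    exists (L : D) (c : forall n, hom (X n) L), is_colimit f c;
  ax_dagger_finite : forall (X : D) (f : hom X X),
    dagger_monic f -> dagger_epic f }.

(* the inverse of the unitor is its dagger *)
Definition scale (D : dagger_rig_category) (a : hom (@one_ob D) one_ob)
    (X Y : D) (f : hom X Y) : hom X Y :=
  mlun (rtimes (rdata D)) Y ∘ (a ⊗₁ f) ∘ (mlun (rtimes (rdata D)) X)^†.
Notation "a ⋅ f" := (scale a f) (at level 40, left associativity) : cat_scope.

Section Scalars.
Context {D : dagger_rig_category} (HD : contraction_axioms D).
Local Notation I := (@one_ob D).
Local Notation O := (@zero_ob D).
Local Notation tO := (ax_terminal HD).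
Local Notation "0" := (zero_mor tO _ _) : cat_scope.
Local Notation M := (rtimes_smc (rlaws D)).
Local Notation P := (rplus_smc (rlaws D)).

Lemma bang_uniq (X : D) (f g : hom X O) : f = g.
Proof. by case: (tO X) => h H; rewrite (H f) (H g). Qed.

Lemma zero_morE (X Y : D) (f : hom X O) (g : hom O Y) : g ∘ f = 0.
Proof.
rewrite /zero_mor (bang_uniq f (bang tO X)); congr (_ ∘ _).
by rewrite -[g]dagK (bang_uniq g^† (bang tO Y)).
Qed.

Lemma comp0m (X Y Z : D) (f : hom X Y) : (0 : hom Y Z) ∘ f = 0.
Proof. by rewrite {1}/zero_mor -compA zero_morE. Qed.

Lemma compm0 (X Y Z : D) (f : hom Y Z) : f ∘ (0 : hom X Y) = 0.
Proof. by rewrite {1}/zero_mor compA zero_morE. Qed.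

Lemma dag0 (X Y : D) : (0 : hom X Y)^† = 0.
Proof. by rewrite /zero_mor dagM dagK. Qed.

Lemma scaleM (a b : hom I I) (X Y Z : D) (f : hom X Y) (g : hom Y Z) :
  (b ∘ a) ⋅ (g ∘ f) = (b ⋅ g) ∘ (a ⋅ f).
Proof.
rewrite /scale /tens1 (mhomM M) !compA -[_ ∘ _^† ∘ mlun _ Y]compA.
by have [-> _] := mlun_iso M Y; rewrite compm1.
Qed.

Lemma scale1 (X Y : D) (f : hom X Y) : idm I ⋅ f = f.
Proof.
rewrite /scale /tens1 (mlun_nat M) -compA.
by have [_ ->] := mlun_iso M X; rewrite compm1.
Qed.

Lemma scale_compl (a : hom I I) (X Y Z : D) (f : hom X Y) (g : hom Y Z) :
  a ⋅ (g ∘ f) = (a ⋅ g) ∘ f.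
Proof. by rewrite -{2}[f]scale1 -scaleM compm1. Qed.

Lemma scale_compr (a : hom I I) (X Y Z : D) (f : hom X Y) (g : hom Y Z) :
  a ⋅ (g ∘ f) = g ∘ (a ⋅ f).
Proof. by rewrite -{2}[g]scale1 -scaleM comp1m. Qed.

Lemma scale_scalar (a b : hom I I) : a ⋅ b = a ∘ b.
Proof.
rewrite -[b]comp1m scale_compl comp1m; congr (_ ∘ _).
rewrite /scale /tens1 (unitors_unit M) (mrun_nat M) -compA.
by have [_ ->] := mrun_iso M I; rewrite compm1.
Qed.

Lemma scalarC (a b : hom I I) : a ∘ b = b ∘ a.
Proof.
by rewrite -scale_scalar -{1}[b]compm1 scale_compr scale_scalar compm1.
Qed.

Lemma scaleA (a b : hom I I) (X Y : D) (f : hom X Y) :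
  a ⋅ (b ⋅ f) = (a ∘ b) ⋅ f.
Proof. by rewrite -[f in RHS]comp1m scaleM -scale_compl comp1m. Qed.

Lemma scaleCA (a b : hom I I) (X Y : D) (f : hom X Y) :
  a ⋅ (b ⋅ f) = b ⋅ (a ⋅ f).
Proof. by rewrite !scaleA scalarC. Qed.

Lemma scale0 (a : hom I I) (X Y : D) : a ⋅ (0 : hom X Y) = 0.
Proof. by rewrite {1}/zero_mor scale_compl zero_morE. Qed.

Lemma scale_dag (a : hom I I) (X Y : D) (f : hom X Y) :
  (a ⋅ f)^† = a^† ⋅ f^†.
Proof. by rewrite /scale /tens1 !dagM (mhom_dag M) dagK compA. Qed.

Lemma idm_neq0 : idm I <> 0.
Proof.
move=> E; have [d [H _]] := ax_superposition HD.
by apply: H; rewrite -[LHS]compm1 E compm0.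
Qed.

(* a dagger monomorphism into I is zero or invertible *)
Lemma dagger_monic_unit (S : D) (m : hom S I) : dagger_monic m ->
  m = 0 \/ exists u : hom I S, m ∘ u = idm I.
Proof.
have d1 : dagger_monic (idm I) by rewrite /dagger_monic dag1 comp1m.
have d0 : dagger_monic (0 : hom O I) by exact: bang_uniq.
have nE (T : D) (n : hom T I) :
    same_subobject (idm I) n -> same_subobject (0 : hom O I) n -> False.
  move=> [u [_ Eu]] [v [[w [_ vw]] Ev]]; apply: idm_neq0.
  by rewrite Eu -[n]compm1 -vw compA -Ev !comp0m.
have sub1 (T : D) (n : hom T I) : same_subobject (idm I) n ->
    same_subobject m n -> m = 0 \/ exists u : hom I S, m ∘ u = idm I.
  move=> [u [_ Eu]] [v [[w [_ vw]] Ev]]; right; exists (w ∘ u).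
  by rewrite Ev compA -(compA n) vw compm1 -Eu.
have sub0 (T : D) (n : hom T I) : same_subobject (0 : hom O I) n ->
    same_subobject m n -> m = 0 \/ exists u : hom I S, m ∘ u = idm I.
  move=> [u [[w [_ uw]] Eu]] [v [_ Ev]]; left.
  by rewrite Ev -[n]compm1 -uw compA -Eu !comp0m.
have [S1 [S2 [m1 [m2 [_ _ _ all2]]]]] := ax_two_subobjects HD.
move=> dm.
case: (all2 _ _ d1) => s1; case: (all2 _ _ d0) => s0;
  case: (all2 _ _ dm) => sm;
  first [by case: (nE _ _ s1 s0)|exact: (sub1 _ _ s1 sm)|exact: (sub0 _ _ s0 sm)].
Qed.

Lemma scale_eq0 (b : hom I I) (X Y : D) (k : hom X Y) :
  b <> 0 -> b ⋅ k = 0 -> k = 0.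
Proof.
move=> b0 bk0.
have kx (x : hom I X) : k ∘ x = 0.
  have [E [m [dm [mE mU]]]] := ax_dagger_equaliser HD (k ∘ x) 0.
  have [|u [mu _]] := mU _ b.
    rewrite comp0m -[b]compm1 -scale_scalar -scale_compr compm1.
    by rewrite scale_compl bk0 comp0m.
  have [m0|[v mv]] := dagger_monic_unit dm.
    by case: b0; rewrite -mu m0 comp0m.
  by rewrite -[LHS]compm1 -mv compA mE -compA comp0m.
have H : k ∘ mrun (rtimes (rdata D)) X = 0.
  apply: (ax_separator HD) => x y; rewrite comp0m.
  rewrite -[y]comp1m -[x]compm1 /tens1 (mhomM M) -compA.
  rewrite (compA (mrun _ _)) (mrun_nat M) -!compA compA kx.
  by rewrite comp0m.
have [_ E] := mrun_iso M X.
by rewrite -[k]compm1 -E compA H comp0m.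
Qed.

Lemma scaleI (b : hom I I) (X Y : D) (f g : hom X Y) :
  b <> 0 -> b ⋅ f = b ⋅ g -> f = g.
Proof.
move=> b0 bfg.
have [E [e [de [eE eU]]]] := ax_dagger_equaliser HD f g.
have [|h [eh _]] := eU _ (b ⋅ idm X); first by rewrite -!scale_compr !compm1.
have [Z [k [kE kU]]] := ax_dagger_kernel HD de.
have k0 : k = 0.
  apply: (scale_eq0 b0).
  by rewrite -[k]compm1 scale_compr -eh compA kE comp0m comp0m.
have [|u [eu _]] := kU _ (idm X); first by rewrite k0.
by rewrite -[f]compm1 -[g]compm1 -eu !compA eE.
Qed.

Lemma scalarM_neq0 (a b : hom I I) : b <> 0 -> a <> 0 -> b ∘ a <> 0.
Proof.
by move=> b0 a0; rewrite -scale_scalar => /(scale_eq0 b0).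
Qed.

Lemma scalar_dag_neq0 (a : hom I I) : a <> 0 -> a^† <> 0.
Proof. by move=> a0 E; apply: a0; rewrite -[a]dagK E dag0. Qed.

Record frac (X Y : D) := Frac {
  num : hom X Y;
  den : hom I I;
  den_neq0 : den <> 0 }.

(* [{classic _}] only provides the choice operator which quotients require. *)
Definition frac_equiv (X Y : D) (p q : {classic frac X Y}) : bool :=
  `[< den q ⋅ num p = den p ⋅ num q >].

Lemma frac_equiv_refl (X Y : D) : reflexive (@frac_equiv X Y).
Proof. by move=> p; apply/asboolP. Qed.

Lemma frac_equiv_sym (X Y : D) : symmetric (@frac_equiv X Y).
Proof. by move=> p q; apply/asboolP/asboolP. Qed.

Lemma frac_equiv_trans (X Y : D) : transitive (@frac_equiv X Y).
Proof.
move=> q p r /asboolP pq /asboolP qr; apply/asboolP.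
apply: (scaleI (@den_neq0 _ _ q)).
by rewrite scaleCA pq scaleCA qr scaleCA.
Qed.

Canonical frac_equiv_rel (X Y : D) := EquivRel (@frac_equiv X Y)
  (@frac_equiv_refl X Y) (@frac_equiv_sym X Y) (@frac_equiv_trans X Y).

Definition loc_hom (X Y : D) : Type := {eq_quot @frac_equiv X Y}.

(* the class f/a, where a0 : a <> 0 *)
Definition mkfrac (X Y : D) (f : hom X Y) (a : hom I I) (a0 : a <> 0) :
  loc_hom X Y := \pi_({eq_quot @frac_equiv X Y}) (Frac f a0).

Lemma mkfrac_eq (X Y : D) (f g : hom X Y) (a b : hom I I)
    (a0 : a <> 0) (b0 : b <> 0) :
  mkfrac f a0 = mkfrac g b0 <-> b ⋅ f = a ⋅ g.
Proof.
split=> [/eqmodP/asboolP //|E].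
by apply/eqmodP/asboolP.
Qed.

Lemma mkfrac_surj (X Y : D) (F : loc_hom X Y) :
  exists f a (a0 : a <> 0), F = mkfrac (f : hom X Y) a0.
Proof.
exists (num (repr F)), (den (repr F)), (@den_neq0 _ _ (repr F)).
by rewrite -{1}[F]reprK /mkfrac; case: (repr F).
Qed.

Definition loc_id (X : D) : loc_hom X X := mkfrac (idm X) idm_neq0.

Definition loc_comp (X Y Z : D) (G : loc_hom Y Z) (F : loc_hom X Y) :
    loc_hom X Z :=
  mkfrac (num (repr G) ∘ num (repr F))
    (scalarM_neq0 (@den_neq0 _ _ (repr G)) (@den_neq0 _ _ (repr F))).

Definition loc_dag (X Y : D) (F : loc_hom X Y) : loc_hom Y X :=
  mkfrac (num (repr F))^† (scalar_dag_neq0 (@den_neq0 _ _ (repr F))).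

Lemma repr_mkfrac (X Y : D) (f : hom X Y) (a : hom I I) (a0 : a <> 0) :
  a ⋅ num (repr (mkfrac f a0)) = den (repr (mkfrac f a0)) ⋅ f.
Proof.
have /eqmodP/asboolP := reprK (mkfrac f a0).
by [].
Qed.

Lemma loc_compE (X Y Z : D) (g : hom Y Z) (b : hom I I) (b0 : b <> 0)
    (f : hom X Y) (a : hom I I) (a0 : a <> 0) :
  loc_comp (mkfrac g b0) (mkfrac f a0) = mkfrac (g ∘ f) (scalarM_neq0 b0 a0).
Proof. by apply/mkfrac_eq; rewrite !scaleM !repr_mkfrac. Qed.

Lemma loc_dagE (X Y : D) (f : hom X Y) (a : hom I I) (a0 : a <> 0) :
  loc_dag (mkfrac f a0) = mkfrac f^† (scalar_dag_neq0 a0).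
Proof. by apply/mkfrac_eq; rewrite -!scale_dag repr_mkfrac. Qed.

Lemma loc_comp1m (X Y : D) (F : loc_hom X Y) : loc_comp (loc_id Y) F = F.
Proof.
have [f [a [a0 ->]]] := mkfrac_surj F; rewrite loc_compE.
by apply/mkfrac_eq; rewrite !comp1m.
Qed.

Lemma loc_compm1 (X Y : D) (F : loc_hom X Y) : loc_comp F (loc_id X) = F.
Proof.
have [f [a [a0 ->]]] := mkfrac_surj F; rewrite loc_compE.
by apply/mkfrac_eq; rewrite !compm1.
Qed.

Lemma loc_compA (W X Y Z : D) (H : loc_hom Y Z) (G : loc_hom X Y)
    (F : loc_hom W X) :
  loc_comp H (loc_comp G F) = loc_comp (loc_comp H G) F.
Proof.
have [f [a [a0 ->]]] := mkfrac_surj F; have [g [b [b0 ->]]] := mkfrac_surj G.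
have [h [c [c0 ->]]] := mkfrac_surj H; rewrite !loc_compE.
by apply/mkfrac_eq; rewrite !compA.
Qed.

Lemma loc_dag1 (X : D) : loc_dag (loc_id X) = loc_id X.
Proof. by rewrite loc_dagE; apply/mkfrac_eq; rewrite !dag1. Qed.

Lemma loc_dagM (X Y Z : D) (G : loc_hom Y Z) (F : loc_hom X Y) :
  loc_dag (loc_comp G F) = loc_comp (loc_dag F) (loc_dag G).
Proof.
have [f [a [a0 ->]]] := mkfrac_surj F; have [g [b [b0 ->]]] := mkfrac_surj G.
rewrite loc_compE !loc_dagE loc_compE.
by apply/mkfrac_eq; rewrite !dagM.
Qed.

Lemma loc_dagK (X Y : D) (F : loc_hom X Y) : loc_dag (loc_dag F) = F.
Proof.
have [f [a [a0 ->]]] := mkfrac_surj F; rewrite !loc_dagE.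
by apply/mkfrac_eq; rewrite !dagK.
Qed.

Definition loc_category : category :=
  @Category D loc_hom loc_id loc_comp loc_comp1m loc_compm1 loc_compA.

Definition localisation : dagger_category :=
  @DaggerCategory loc_category loc_dag loc_dag1 loc_dagM loc_dagK.

End Scalars.


Section LocalisationFunctor.
Context {D : dagger_rig_category} (HD : contraction_axioms D).
Local Notation I := (@one_ob D).
Local Notation C := (localisation HD).

Lemma fracM (X Y Z : D) (g : hom Y Z) (b : hom I I)
    (b0 : b <> zero_mor (ax_terminal HD) I I)
    (f : hom X Y) (a : hom I I) (a0 : a <> zero_mor (ax_terminal HD) I I) :
  (mkfrac g b0 : @hom C Y Z) ∘ (mkfrac f a0 : @hom C X Y) =
  mkfrac (g ∘ f) (scalarM_neq0 b0 a0).
Proof. exact: loc_compE. Qed.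

Lemma frac_dag (X Y : D) (f : hom X Y) (a : hom I I)
    (a0 : a <> zero_mor (ax_terminal HD) I I) :
  (mkfrac f a0 : @hom C X Y)^† = mkfrac f^† (scalar_dag_neq0 a0).
Proof. exact: loc_dagE. Qed.

Definition loc_functor (X Y : D) (f : hom X Y) : @hom C X Y :=
  mkfrac f (@idm_neq0 D HD).

End LocalisationFunctor.

Section Addition.
Context {D : dagger_rig_category} (HD : contraction_axioms D).
Local Notation I := (@one_ob D).
Local Notation O := (@zero_ob D).
Local Notation tO := (ax_terminal HD).
Local Notation "0" := (zero_mor tO _ _) : cat_scope.
Local Notation M := (rtimes_smc (rlaws D)).
Local Notation P := (rplus_smc (rlaws D)).
Local Notation R := (rlaws D).
Local Notation C := (localisation HD).
Local Notation U := (loc_functor HD).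
Local Notation p1 X Y := (bproj1 tO X Y).
Local Notation p2 X Y := (bproj2 tO X Y).

Lemma oplus1M (A A' A'' B B' B'' : D) (f' : hom A' A'') (f : hom A A')
    (g' : hom B' B'') (g : hom B B') :
  (f' ∘ f) ⊕₁ (g' ∘ g) = (f' ⊕₁ g') ∘ (f ⊕₁ g).
Proof. exact: mhomM P _ _ _ _ _ _ _ _ _ _. Qed.

Lemma bproj2E (X Y : D) :
  p2 X Y = mlun (rplus (rdata D)) Y ∘ ((0 : hom X O) ⊕₁ idm Y).
Proof.
by rewrite /bproj2 /binj2 dagM dagK /oplus1 (mhom_dag P) dag0 dag1.
Qed.

Lemma bproj1E (X Y : D) : p1 X Y = p2 Y X ∘ msym (rplus (rdata D)) X Y.
Proof.
rewrite bproj2E /bproj1 /binj1 dagM dagK /oplus1 (mhom_dag P) dag0 dag1.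
by rewrite -(msym_unit P) -!compA (msym_nat P).
Qed.

Lemma bproj2_nat (X X' Y Y' : D) (f : hom X X') (g : hom Y Y') :
  p2 X' Y' ∘ (f ⊕₁ g) = g ∘ p2 X Y.
Proof.
rewrite !bproj2E -compA -oplus1M comp1m comp0m compA.
rewrite -(mlun_nat P) -compA; congr (_ ∘ _).
by rewrite -/(oplus1 _ _) -oplus1M compm1 comp1m.
Qed.

Lemma bproj1_nat (X X' Y Y' : D) (f : hom X X') (g : hom Y Y') :
  p1 X' Y' ∘ (f ⊕₁ g) = f ∘ p1 X Y.
Proof.
rewrite !bproj1E -compA /oplus1 (msym_nat P) compA.
by rewrite -/(oplus1 _ _) bproj2_nat compA.
Qed.

Lemma bproj2_distl (A X Y : D) :
  p2 (A ⊗ X) (A ⊗ Y) ∘ distl (rdata D) A X Y = idm A ⊗₁ p2 X Y.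
Proof.
rewrite !bproj2E -[idm A in RHS]comp1m /tens1 (mhomM M) -(distl_zero R).
rewrite -!compA (distl_nat R); congr (_ ∘ _); rewrite !compA; congr (_ ∘ _).
rewrite -(mhomM P) comp1m (mhom1 M); congr (mhom _ _ _).
exact: bang_uniq.
Qed.

Lemma bproj1_distl (A X Y : D) :
  p1 (A ⊗ X) (A ⊗ Y) ∘ distl (rdata D) A X Y = idm A ⊗₁ p1 X Y.
Proof.
rewrite !bproj1E -compA (distl_sym R) compA.
have := bproj2_distl A Y X; rewrite /tens /oplus => ->.
by rewrite /tens1 -(mhomM M) comp1m.
Qed.

Lemma proj_jointly_monic (W X Y : D) (f g : hom W (X ⊕ Y)) :
  p1 X Y ∘ f = p1 X Y ∘ g -> p2 X Y ∘ f = p2 X Y ∘ g -> f = g.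
Proof.
move=> E1 E2; rewrite -[f]dagK -[g]dagK; congr (_^†).
apply: (@ax_jointly_epic D HD X Y W).
  by have := congr1 dag E1; rewrite /bproj1 !dagM !dagK.
by have := congr1 dag E2; rewrite /bproj2 !dagM !dagK.
Qed.

Lemma scale_run (a : hom I I) (X : D) :
  mrun (rtimes (rdata D)) X ∘ (idm X ⊗₁ a) ∘ (mrun (rtimes (rdata D)) X)^† =
  a ⋅ idm X.
Proof.
rewrite -(msym_unit M) dagM !compA /scale -[_ ∘ msym _ _ _ ∘ _]compA.
rewrite /tens1 (msym_nat M) compA -[_ ∘ msym _ _ _ ∘ _]compA.
by have [_ ->] := msym_iso M X I; rewrite compm1.
Qed.

Lemma scaled_diagonal : exists x y : hom I I, [/\ x <> 0, y <> 0 &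
  forall X : D, exists d : hom X (X ⊕ X),
    p1 X X ∘ d = x ⋅ idm X /\ p2 X X ∘ d = y ⋅ idm X].
Proof.
have [d [x0 y0]] := ax_superposition HD.
exists (p1 I I ∘ d), (p2 I I ∘ d); split=> // X.
pose r := mrun (rtimes (rdata D)) X.
exists ((r ⊕₁ r) ∘ distl (rdata D) X I I ∘ (idm X ⊗₁ d) ∘ r^†).
split; rewrite -scale_run !compA.
  rewrite bproj1_nat -(compA r); congr (_ ∘ _); rewrite -compA; congr (_ ∘ _).
  by rewrite bproj1_distl /tens1 -(mhomM M) comp1m.
rewrite bproj2_nat -(compA r); congr (_ ∘ _); rewrite -compA; congr (_ ∘ _).
by rewrite bproj2_distl /tens1 -(mhomM M) comp1m.
Qed.

Lemma scale_oplus (a : hom I I) (X X' Y Y' : D) (f : hom X X') (g : hom Y Y') :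
  a ⋅ (f ⊕₁ g) = (a ⋅ f) ⊕₁ (a ⋅ g).
Proof.
rewrite /scale !oplus1M -!(distl_unit R) dagM -!compA; congr (_ ∘ _).
rewrite /oplus1 (mhom_dag P) !compA; congr (_ ∘ _).
rewrite (distl_nat R) -compA.
by have [_ ->] := distl_iso R I X Y; rewrite compm1.
Qed.

Definition loc_oplus (X X' Y Y' : D) (F : @hom C X X') (G : @hom C Y Y') :
    @hom C (X ⊕ Y) (X' ⊕ Y') :=
  mkfrac ((den (repr G) ⋅ num (repr F)) ⊕₁ (den (repr F) ⋅ num (repr G)))
    (scalarM_neq0 (@den_neq0 _ _ _ _ (repr F)) (@den_neq0 _ _ _ _ (repr G))).

Lemma loc_oplusE (X X' Y Y' : D) (f : hom X X') (a : hom I I) (a0 : a <> 0)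
    (g : hom Y Y') (b : hom I I) (b0 : b <> 0) :
  loc_oplus (mkfrac f a0) (mkfrac g b0) =
  mkfrac ((b ⋅ f) ⊕₁ (a ⋅ g)) (scalarM_neq0 a0 b0).
Proof.
apply/mkfrac_eq; rewrite !scale_oplus -!scaleA.
have := repr_mkfrac f a0; have := repr_mkfrac g b0.
move: (repr (mkfrac f a0)) (repr (mkfrac g b0)) => [f' a' ?] [g' b' ?] /= Eg Ef.
congr (_ ⊕₁ _).
  by rewrite !(scaleCA a) Ef !(scaleCA a') scaleCA.
by rewrite !(scaleCA b) Eg !(scaleCA a).
Qed.

Lemma loc_pair_ex (W X Y : D) (F : @hom C W X) (G : @hom C W Y) :
  exists H : @hom C W (X ⊕ Y), U (p1 X Y) ∘ H = F /\ U (p2 X Y) ∘ H = G.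
Proof.
have [x [y [x0 y0 dX]]] := scaled_diagonal; have [d [d1 d2]] := dX W.
have [f [a [a0 ->]]] := mkfrac_surj F; have [g [b [b0 ->]]] := mkfrac_surj G.
pose h := ((b ⋅ (y ⋅ f)) ⊕₁ (a ⋅ (x ⋅ g))) ∘ d.
exists (mkfrac h (scalarM_neq0 (scalarM_neq0 a0 b0) (scalarM_neq0 x0 y0))).
rewrite /h /loc_functor !fracM; split; apply/mkfrac_eq; rewrite comp1m compA.
  rewrite bproj1_nat -(compA _ (p1 W W) d) d1 -scale_compr compm1 -!scaleA.
  by rewrite (scaleCA x b).
rewrite bproj2_nat -(compA _ (p2 W W) d) d2 -scale_compr compm1 -!scaleA.
by rewrite (scaleCA y a) (scaleCA b a) (scaleCA y x).
Qed.

Lemma loc_proj_jointly_monic (W X Y : D) (H K : @hom C W (X ⊕ Y)) :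
  U (p1 X Y) ∘ H = U (p1 X Y) ∘ K -> U (p2 X Y) ∘ H = U (p2 X Y) ∘ K -> H = K.
Proof.
have [h [a [a0 ->]]] := mkfrac_surj H; have [k [b [b0 ->]]] := mkfrac_surj K.
rewrite /loc_functor !fracM => /mkfrac_eq E1 /mkfrac_eq E2.
apply/mkfrac_eq; rewrite !comp1m in E1 E2.
by apply: proj_jointly_monic; rewrite -!scale_compr.
Qed.

(* the pairing <F, G> of the biproduct; it is unique by the previous lemma *)
Definition loc_pair (W X Y : D) (F : @hom C W X) (G : @hom C W Y) :
  @hom C W (X ⊕ Y) := sval (cid (loc_pair_ex F G)).

Lemma loc_pairP (W X Y : D) (F : @hom C W X) (G : @hom C W Y) :
  U (p1 X Y) ∘ loc_pair F G = F /\ U (p2 X Y) ∘ loc_pair F G = G.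
Proof. exact: svalP (cid (loc_pair_ex F G)). Qed.

Definition loc_diag (X : D) : @hom C X (X ⊕ X) :=
  loc_pair (idm (X : C)) (idm (X : C)).

(* Since i_k is the dagger of p_k, the codiagonal [1, 1] is the dagger of the
   diagonal. *)
Definition loc_codiag (X : D) : @hom C (X ⊕ X) X := (loc_diag X)^†.

Definition loc_add (X Y : D) (F G : @hom C X Y) : @hom C X Y :=
  loc_codiag Y ∘ loc_oplus F G ∘ loc_diag X.

Lemma loc_oplusM (X X' X'' Y Y' Y'' : D) (F' : @hom C X' X'') (F : @hom C X X')
    (G' : @hom C Y' Y'') (G : @hom C Y Y') :
  loc_oplus (F' ∘ F) (G' ∘ G) = loc_oplus F' G' ∘ loc_oplus F G.
Proof.
have [f [a [a0 ->]]] := mkfrac_surj F; have [g [b [b0 ->]]] := mkfrac_surj G.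
have [f' [c [c0 ->]]] := mkfrac_surj F'; have [g' [e [e0 ->]]] := mkfrac_surj G'.
rewrite (loc_oplusE f' c0 g' e0) (loc_oplusE f a0 g b0) !fracM loc_oplusE.
rewrite -oplus1M -!scaleM; apply/mkfrac_eq.
by rewrite -!compA (compA e a) (scalarC e a) -compA.
Qed.

Lemma loc_oplus_dag (X X' Y Y' : D) (F : @hom C X X') (G : @hom C Y Y') :
  (loc_oplus F G)^† = loc_oplus F^† G^†.
Proof.
have [f [a [a0 ->]]] := mkfrac_surj F; have [g [b [b0 ->]]] := mkfrac_surj G.
rewrite (loc_oplusE f a0 g b0) !frac_dag loc_oplusE; apply/mkfrac_eq.
by rewrite /oplus1 (mhom_dag P) !scale_dag dagM scalarC.
Qed.

End Addition.

Section PositiveScalars.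
Context {D : dagger_rig_category} (HD : contraction_axioms D).
Local Notation I := (@one_ob D).
Local Notation C := (localisation HD).
Local Notation U := (loc_functor HD).

(* the morphisms (X, x) --> (Y, y) of the comma category from I to U *)
Definition comma_hom (X Y : D) (x : @hom C I X) (y : @hom C I Y)
  (f : hom X Y) : Prop := y = U f ∘ x.

Definition is_positive (r : @hom C I I) : Prop :=
  exists (X : D) (x : @hom C I X), r = x^† ∘ x.

Definition Rplus : Type := {r : @hom C I I | is_positive r}.

Lemma is_positive_add (r s : @hom C I I) :
  is_positive r -> is_positive s -> is_positive (loc_add r s).
Proof.
move=> [X [x ->]] [Y [y ->]].
exists (X ⊕ Y), (loc_oplus x y ∘ loc_diag HD I).
by rewrite /loc_add loc_oplusM dagM loc_oplus_dag !compA.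
Qed.

Definition Radd (r s : Rplus) : Rplus :=
  exist _ (loc_add (sval r) (sval s)) (is_positive_add (svalP r) (svalP s)).

(* s <= r iff there is a morphism (X, x) --> (Y, y) for some representations
   r = x^† x and s = y^† y: the morphism goes from the larger scalar to the
   smaller one. *)
Definition Rle (s r : Rplus) : Prop :=
  exists (X Y : D) (x : @hom C I X) (y : @hom C I Y),
    [/\ sval r = x^† ∘ x, sval s = y^† ∘ y & exists f, comma_hom x y f].

Definition Rincreasing (b : nat -> Rplus) : Prop :=
  forall n, Rle (b n) (b n.+1).

Definition Rupper_bound (b : nat -> Rplus) (u : Rplus) : Prop :=
  forall n, Rle (b n) u.

Definition Rsup (b : nat -> Rplus) (s : Rplus) : Prop :=
  Rupper_bound b s /\ forall u, Rupper_bound b u -> Rle s u.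

End PositiveScalars.

(* Main.v *)
From mathcomp Require Import all_boot.
From mathcomp Require Import boolp.
Require Import Defs.

(** A positive scalar is the squared norm [x^† ∘ x] of a vector [x : I --> X] of
    the localisation, and after restricting [x] to its image we may assume that
    morphisms of [D] are determined by their value at [x] ([generating]). The
    order then reads: [x^†x >= y^†y] exactly when a morphism of [D] sends [x] to
    [y], for all representatives [x] and [y] ([normsq_le]).

    Suprema. An increasing sequence [x_n^†x_n] is a sequence of morphisms
    [X_(n+1) --> X_n] matching the vectors; taking daggers gives a sequential
    diagram [X_0 --> X_1 --> ...] in [D]. An upper bound [y^†y] gives morphisms
    [Y --> X_n] sending [y] to [x_n]; when all these vectors are generating they
    are epic and compatible, so that their daggers are a cocone of
    monomorphisms. Hence the diagram has a colimit [c_n : X_n --> L], and the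
    induced map [L --> Y], read backwards, carries [y] to a vector [s] of [L]
    with [c_n^† s = x_n]. This vector is determined by these equations, as the
    [c_n] are jointly epic, so that every upper bound maps to the same [s], and
    [s^†s] is the supremum ([Rsup_colimit]).

    Addition. The sum of [a^†a] and [x^†x] is the squared norm of the vector
    [(a, x)] of [A ⊕ X]. By the same argument it therefore suffices that
    [A ⊕ -] preserves the colimit ([oplus_colimit]). The colimit [M] of the
    [A ⊕ X_n] contains [A] and [L] as retracts, and the comparison map
    [M --> A ⊕ L] is inverted by its own dagger as soon as each retraction is
    the dagger of its section. This last fact ([retraction_dag]) expresses that
    the morphisms of [D] behave as contractions: isomorphisms are unitary, and
    split monomorphisms are isometries. *)

Set Implicit Arguments.
Unset Strict Implicit.
Unset Printing Implicit Defensive.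

Local Open Scope cat_scope.

(** * Dagger monomorphisms, retracts and images *)

Section DaggerMonos.
Context {D : dagger_rig_category} (HD : contraction_axioms D).
Local Notation O := (@zero_ob D).
Local Notation tO := (ax_terminal HD).
Local Notation "0" := (zero_mor tO _ _) : cat_scope.

Lemma dagger_monicM (X Y Z : D) (g : hom Y Z) (f : hom X Y) :
  dagger_monic g -> dagger_monic f -> dagger_monic (g ∘ f).
Proof.
by rewrite /dagger_monic => dg df; rewrite dagM compA -(compA f^†) dg compm1.
Qed.

Lemma iso_epic (X Y : D) (f : hom X Y) : is_iso f -> epic f.
Proof.
move=> [v [_ fv]] Z g h E.
by rewrite -[g]compm1 -[h]compm1 -fv !compA E.
Qed.

Lemma epic_dag_monic (X Y : D) (f : hom X Y) : epic f -> monic f^†.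
Proof.
move=> ef W g h E; rewrite -[g]dagK -[h]dagK; congr (_^†); apply: ef.
by rewrite -[f]dagK -!dagM E.
Qed.

(** The axiom that [x^†x] determines [x] up to isomorphism, read from right to
    left at [x = 1]: isomorphisms preserve norms. *)
Lemma iso_dagger_monic (X Y : D) (f : hom X Y) : is_iso f -> dagger_monic f.
Proof.
move=> fi.
have e1 : epic (idm X) by move=> Z g h; rewrite !compm1.
have [_ H] := ax_positive HD e1 (iso_epic fi).
have /H : exists f' : hom X Y, is_iso f' /\ f = f' ∘ idm X.
  by exists f; rewrite compm1.
by rewrite dag1 comp1m.
Qed.

(** The section corestricts to an isomorphism onto the equaliser of the
    idempotent [g ∘ r] with the identity, which is a dagger monomorphism. *)
Lemma section_dagger_monic (A M : D) (g : hom A M) (r : hom M A) :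
  r ∘ g = idm A -> dagger_monic g.
Proof.
move=> rg.
have [E [e [de [eE eU]]]] := ax_dagger_equaliser HD (g ∘ r) (idm M).
have [|g' [eg' _]] := eU _ g; first by rewrite -compA rg compm1 comp1m.
rewrite -eg'; apply: dagger_monicM => //; apply: iso_dagger_monic.
exists (r ∘ e); split; first by rewrite -compA eg'.
rewrite -[g' ∘ _]comp1m -de -!compA; congr (_ ∘ _).
by rewrite !compA eg' eE comp1m.
Qed.

(** Both [g] and [r^†] are isometries, and both factor through the equaliser
    of [r] and [g^†]. Since this equaliser is an isometry too, comparing the
    two factorisations of [r] and [g^†] restricted to it identifies them. *)
Lemma retraction_dag (A M : D) (g : hom A M) (r : hom M A) :
  r ∘ g = idm A -> r = g^†.
Proof.
move=> rg; have dg := section_dagger_monic rg.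
have rg' : g^† ∘ r^† = idm A by rewrite -dagM rg dag1.
have dr := section_dagger_monic rg'.
rewrite /dagger_monic dagK in dr.
have [E [d [dd [dE dU]]]] := ax_dagger_equaliser HD r g^†.
have [|g' [dg' _]] := dU _ g; first by rewrite rg dg.
have [|r' [dr' _]] := dU _ r^†; first by rewrite dr rg'.
have rE : r = r'^† ∘ d^† by rewrite -dagM dr' dagK.
move: dE; rewrite {1}rE -{1}dg' dagM -!compA dd !compm1 => r'E.
by rewrite rE r'E -dagM dg'.
Qed.

(** Every morphism factors through its image, the orthogonal complement of the
    kernel of its dagger. That [e] is epic: it factors through the equaliser
    [d] of any two maps that agree after [e]. The dagger monomorphism [m ∘ d]
    is the kernel of some [f]; then [f] vanishes on [x], hence on all of the
    image, so that [m] factors through [m ∘ d] and the two maps are equal. *)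
Lemma image_factorisation (A X : D) (x : hom A X) :
  exists (S : D) (m : hom S X) (e : hom A S),
    [/\ dagger_monic m, epic e & x = m ∘ e].
Proof.
have [K [k [_ [kE kU]]]] := ax_dagger_equaliser HD x^† 0.
have [S [m [dm [mE mU]]]] := ax_dagger_equaliser HD k^† 0.
rewrite comp0m in kE; rewrite comp0m in mE.
have [|e [me _]] := mU _ x.
  by rewrite comp0m -[x]dagK -dagM kE dag0.
exists S, m, e; split=> // Z g h ghe.
have [E [d [dd [dE dU]]]] := ax_dagger_equaliser HD g h.
have [e' [de' _]] := dU _ _ ghe.
have [W [f [fE fU]]] := ax_dagger_kernel HD (dagger_monicM dm dd).
rewrite comp0m in fE.
have fx : f ∘ x = 0 by rewrite -me -de' !compA -(compA f) fE comp0m.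
have [|l [kl _]] := kU _ f^†.
  by rewrite comp0m -dagM fx dag0.
have fm : f ∘ m = 0 by rewrite -[f]dagK -kl dagM -compA mE compm0.
have [|u [mdu _]] := fU _ m; first by rewrite fm comp0m.
have du : d ∘ u = idm S by rewrite -[d ∘ u]comp1m -dm -compA (compA m) mdu.
by rewrite -[g]compm1 -[h]compm1 -du !compA dE.
Qed.

End DaggerMonos.

(** * Generating vectors and the order on squared norms *)

Section Vectors.
Context {D : dagger_rig_category} (HD : contraction_axioms D).
Local Notation I := (@one_ob D).
Local Notation tO := (ax_terminal HD).
Local Notation "0" := (zero_mor tO _ _) : cat_scope.
Local Notation C := (localisation HD).
Local Notation U := (loc_functor HD).

Lemma loc_functorM (X Y Z : D) (g : hom Y Z) (f : hom X Y) :
  U (g ∘ f) = U g ∘ U f.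
Proof. by rewrite /loc_functor fracM; apply/mkfrac_eq; rewrite comp1m. Qed.

Lemma loc_functor1 (X : D) : U (idm X) = idm (X : C).
Proof. by []. Qed.

Lemma loc_functor_dag (X Y : D) (f : hom X Y) : U f^† = (U f)^†.
Proof. by rewrite /loc_functor frac_dag; apply/mkfrac_eq; rewrite dag1. Qed.

Lemma loc_functor_frac (X Y Z : D) (f : hom Y Z) (x : hom X Y) (a : hom I I)
    (a0 : a <> 0) :
  U f ∘ (mkfrac x a0 : @hom C X Y) = mkfrac (f ∘ x) a0.
Proof. by rewrite /loc_functor fracM; apply/mkfrac_eq; rewrite comp1m. Qed.

(** Clearing denominators, a jointly epic family of [D] also separates the
    vectors of the localisation. *)
Lemma loc_jointly_monic (T : Type) (X : T -> D) (L : D)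
    (c : forall t, hom (X t) L) :
  (forall M (u v : hom L M), (forall t, u ∘ c t = v ∘ c t) -> u = v) ->
  forall x y : @hom C I L,
    (forall t, U (c t)^† ∘ x = U (c t)^† ∘ y) -> x = y.
Proof.
move=> cE F G; have [f [a [a0 ->]]] := mkfrac_surj F.
have [g [b [b0 ->]]] := mkfrac_surj G => E; apply/mkfrac_eq.
rewrite -[LHS]dagK -[RHS]dagK; congr (_^†); apply: cE => t.
rewrite -[c t]dagK -!dagM; congr (_^†).
have := E t; rewrite !loc_functor_frac => /mkfrac_eq.
by rewrite !scale_compr.
Qed.

Definition generating (X : D) (x : @hom C I X) : Prop :=
  forall (Z : D) (f g : hom X Z), U f ∘ x = U g ∘ x -> f = g.

Lemma generating_frac (X : D) (e : hom I X) (a : hom I I) (a0 : a <> 0) :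
  epic e -> generating (mkfrac e a0 : @hom C I X).
Proof.
move=> ee Z f g; rewrite !loc_functor_frac => /mkfrac_eq /(scaleI a0).
exact: ee.
Qed.

Lemma generating_comp_epic (X Y : D) (x : @hom C I X) (g : hom X Y) :
  generating (U g ∘ x) -> epic g.
Proof. by move=> gx Z f h E; apply: gx; rewrite !compA -!loc_functorM E. Qed.

(** Taking the image of the numerator suffices, since nonzero scalars can be
    cancelled. The second factor is left as an explicit fraction, because the
    positivity axiom speaks of epimorphisms of [D]. *)
Lemma generating_restriction (X : D) (x : @hom C I X) :
  exists (S : D) (m : hom S X) (e : hom I S) (a : hom I I) (a0 : a <> 0),
    [/\ dagger_monic m, epic e & x = U m ∘ (mkfrac e a0 : @hom C I S)].
Proof.
have [f [a [a0 ->]]] := mkfrac_surj x.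
have [S [m [e [dm ee ->]]]] := image_factorisation HD f.
by exists S, m, e, a, a0; rewrite loc_functor_frac.
Qed.

(** For epic fractions [e / a] and [e' / a'] this is the positivity axiom
    applied to the epimorphisms [a' ⋅ e] and [a ⋅ e'] of [D]. *)
Lemma eq_normsq_hom (X X' : D) (x : @hom C I X) (x' : @hom C I X') :
  x^† ∘ x = x'^† ∘ x' -> exists f : hom X X', x' = U f ∘ x.
Proof.
have [S [m [e [a [a0 [dm ee ->]]]]]] := generating_restriction x.
have [S' [m' [e' [a' [a'0 [dm' ee' ->]]]]]] := generating_restriction x'.
have epic_scale (Y : D) (k : hom I Y) b : b <> 0 -> epic k -> epic (b ⋅ k).
  by move=> b0 ek Z g h; rewrite -!scale_compr => /(scaleI b0)/ek.
rewrite !loc_functor_frac !frac_dag !fracM => /mkfrac_eq.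
rewrite !dagM !compA -(compA e^†) -(compA e'^†) dm dm' !compm1 => E.
have [|f [_ Ef]] := (ax_positive HD (epic_scale _ _ _ a'0 ee)
  (epic_scale _ _ _ a0 ee')).1.
  by rewrite !scale_dag -!scaleM.
exists (m' ∘ f ∘ m^†); rewrite loc_functor_frac; apply/mkfrac_eq.
rewrite -!compA (compA m^†) dm comp1m -!scale_compr in Ef *.
by rewrite scale_compr Ef -scale_compr.
Qed.

Definition normsq (X : D) (x : @hom C I X) : Rplus HD :=
  exist _ (x^† ∘ x) (ex_intro _ X (ex_intro _ x erefl)).

Lemma Rplus_inj (r s : Rplus HD) : sval r = sval s -> r = s.
Proof.
case: r s => [r Hr] [s Hs] /= E; case: s / E Hs => Hs.
by congr exist; apply: Prop_irrelevance.
Qed.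

Lemma normsq_generating (r : Rplus HD) :
  exists (X : D) (x : @hom C I X), generating x /\ r = normsq x.
Proof.
have [X [x rE]] := svalP r.
have [S [m [e [a [a0 [dm ee xE]]]]]] := generating_restriction x.
exists S, (mkfrac e a0); split; first exact: generating_frac.
apply: Rplus_inj; rewrite rE xE dagM -loc_functor_dag -compA.
by rewrite (compA (U m^†)) -loc_functorM dm loc_functor1 comp1m.
Qed.

(** The order does not depend on representatives: [eq_normsq_hom] moves between
    two representatives of the same scalar. *)
Lemma normsq_le (X Y : D) (x : @hom C I X) (y : @hom C I Y) :
  Rle (normsq y) (normsq x) <-> exists f : hom X Y, y = U f ∘ x.
Proof.
split=> [[X' [Y' [x' [y' [xE yE [f fE]]]]]]|[f ->]]; last first.
  by exists X, Y, x, (U f ∘ x); split=> //; exists f.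
have [g gE] := eq_normsq_hom xE; have [h hE] := eq_normsq_hom (esym yE).
by exists (h ∘ f ∘ g); rewrite hE fE gE !loc_functorM !compA.
Qed.

Lemma Rle_trans (r s t : Rplus HD) : Rle r s -> Rle s t -> Rle r t.
Proof.
have [X [x [_ ->]]] := normsq_generating r.
have [Y [y [_ ->]]] := normsq_generating s.
have [Z [z [_ ->]]] := normsq_generating t.
rewrite !normsq_le => -[f ->] [g ->].
by exists (f ∘ g); rewrite loc_functorM compA.
Qed.

(** * Sums of squared norms *)

Definition vpair (X Y : D) (x : @hom C I X) (y : @hom C I Y) :
  @hom C I (X ⊕ Y) := loc_oplus x y ∘ loc_diag HD I.

Lemma Radd_normsq (X Y : D) (x : @hom C I X) (y : @hom C I Y) :
  Radd (normsq x) (normsq y) = normsq (vpair x y).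
Proof.
apply: Rplus_inj.
transitivity ((vpair x y)^† ∘ vpair x y); last by [].
rewrite /vpair dagM loc_oplus_dag -compA.
by rewrite (compA (loc_oplus _ _)) -loc_oplusM compA.
Qed.

Lemma vpair_oplus (X X' Y Y' : D) (x : @hom C I X) (y : @hom C I Y)
    (f : hom X X') (g : hom Y Y') :
  U (f ⊕₁ g) ∘ vpair x y = vpair (U f ∘ x) (U g ∘ y).
Proof.
rewrite /vpair loc_oplusM compA; congr (_ ∘ _ ∘ _).
rewrite /loc_functor loc_oplusE; apply/mkfrac_eq.
by rewrite comp1m !scale1.
Qed.

Lemma Radd_le (a r s : Rplus HD) : Rle r s -> Rle (Radd a r) (Radd a s).
Proof.
have [A [α [_ ->]]] := normsq_generating a.
have [X [x [_ ->]]] := normsq_generating r.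
have [Y [y [_ ->]]] := normsq_generating s.
rewrite !Radd_normsq !normsq_le => -[f ->]; exists (idm A ⊕₁ f).
by rewrite vpair_oplus loc_functor1 comp1m.
Qed.

End Vectors.

(** * Sequential colimits and the biproduct *)

Section Colimits.
Context {D : dagger_rig_category} (HD : contraction_axioms D).
Local Notation O := (@zero_ob D).
Local Notation tO := (ax_terminal HD).
Local Notation "0" := (zero_mor tO _ _) : cat_scope.
Local Notation i1 X Y := (binj1 tO X Y).
Local Notation i2 X Y := (binj2 tO X Y).
Local Notation p1 X Y := (bproj1 tO X Y).
Local Notation p2 X Y := (bproj2 tO X Y).
Local Notation P := (rplus_smc (rlaws D)).

Lemma oplus1_id (X Y : D) : idm X ⊕₁ idm Y = idm (X ⊕ Y).
Proof. exact: mhom1 P _ _. Qed.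

Lemma oplus1_dag (X X' Y Y' : D) (f : hom X X') (g : hom Y Y') :
  (f ⊕₁ g)^† = f^† ⊕₁ g^†.
Proof. exact: mhom_dag P _ _ _ _ _ _. Qed.

Lemma oplus_binj1 (X X' Y Y' : D) (f : hom X X') (g : hom Y Y') :
  (f ⊕₁ g) ∘ i1 X Y = i1 X' Y' ∘ f.
Proof.
have := congr1 dag (bproj1_nat HD f^† g^†).
by rewrite /bproj1 !dagM oplus1_dag !dagK.
Qed.

Lemma oplus_binj2 (X X' Y Y' : D) (f : hom X X') (g : hom Y Y') :
  (f ⊕₁ g) ∘ i2 X Y = i2 X' Y' ∘ g.
Proof.
have := congr1 dag (bproj2_nat HD f^† g^†).
by rewrite /bproj2 !dagM oplus1_dag !dagK.
Qed.

Lemma bproj2_binj2 (X Y : D) : p2 X Y ∘ i2 X Y = idm Y.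
Proof.
rewrite bproj2E /binj2 !compA -(compA (mlun _ _)) -oplus1M comp1m.
rewrite (_ : 0 ∘ _ = idm O); last exact: bang_uniq.
by rewrite oplus1_id compm1; have [_] := mlun_iso P Y.
Qed.

Lemma bproj1_binj1 (X Y : D) : p1 X Y ∘ i1 X Y = idm X.
Proof.
rewrite /bproj1 /binj1 dagM oplus1_dag dag1 dag0 dagK.
rewrite !compA -(compA (mrun _ _)) -oplus1M comp1m.
rewrite (_ : 0 ∘ _ = idm O); last exact: bang_uniq.
by rewrite oplus1_id compm1; have [_] := mrun_iso P X.
Qed.

Lemma colimit_jointly_epic (X : nat -> D) (f : forall n, hom (X n) (X n.+1))
    (L : D) (c : forall n, hom (X n) L) :
  is_colimit f c ->
  forall M (u v : hom L M), (forall n, u ∘ c n = v ∘ c n) -> u = v.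
Proof.
move=> [cc cU] M u v E.
have [|w [_ wU]] := cU M (fun n => v ∘ c n).
  by move=> n; rewrite -compA cc.
by rewrite -(wU u E) -(wU v (fun=> erefl)).
Qed.

(** Let [M] be a colimit of the [A ⊕ X n]. The comparison map
    [t : M --> A ⊕ L] has components the retractions of [j : A --> M] and
    [l : L --> M]. These retractions are [j^†] and [l^†], so that [t^†]
    restricts to [j] and [l] and is inverse to [t]. *)
Lemma oplus_colimit (A : D) (X : nat -> D) (f : forall n, hom (X n) (X n.+1))
    (L : D) (c : forall n, hom (X n) L) :
  bounded_sequence f -> is_colimit f c ->
  is_colimit (fun n => idm A ⊕₁ f n) (fun n => idm A ⊕₁ c n).
Proof.
move=> [B [g [gc gm]]] cL; have [cc cU] := cL.
have [|M [k kM]] := @ax_bounded_colimit D HD _ (fun n => idm A ⊕₁ f n).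
  exists (A ⊕ B), (fun n => idm A ⊕₁ g n); split.
    by move=> n; rewrite -oplus1M gc comp1m.
  move=> n W h h' E; apply: (proj_jointly_monic (HD := HD)).
    have := congr1 (comp (p1 A B)) E.
    by rewrite !compA !bproj1_nat !comp1m.
  apply: gm; have := congr1 (comp (p2 A B)) E.
  by rewrite !compA !bproj2_nat.
have [kc kU] := kM.
have kE := colimit_jointly_epic kM.
have cE := colimit_jointly_epic cL.
have cocone_oplus : is_cocone (fun n => idm A ⊕₁ f n) (fun n => idm A ⊕₁ c n).
  by move=> n; rewrite -oplus1M cc comp1m.
have [t [tk _]] := kU _ _ cocone_oplus.
pose j := k 0%N ∘ i1 A (X 0%N).
have jE n : k n ∘ i1 A (X n) = j.
  elim: n => [//|n <-]; rewrite -(kc n) -compA oplus_binj1.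
  by rewrite compm1.
have [|l [lc _]] := cU M (fun n => k n ∘ i2 A (X n)).
  by move=> n; rewrite -compA -(oplus_binj2 (idm A)) compA kc.
have tj : t ∘ j = i1 A L by rewrite compA tk oplus_binj1 compm1.
have tl : t ∘ l = i2 A L.
  by apply: cE => n; rewrite -compA lc compA tk oplus_binj2.
have jd : t^† ∘ i1 A L = j.
  rewrite -[j]dagK -(retraction_dag HD (g := j) (r := p1 A L ∘ t)).
    by rewrite dagM dagK.
  by rewrite -compA tj bproj1_binj1.
have ld : t^† ∘ i2 A L = l.
  rewrite -[l]dagK -(retraction_dag HD (g := l) (r := p2 A L ∘ t)).
    by rewrite dagM dagK.
  by rewrite -compA tl bproj2_binj2.
have tt' : t ∘ t^† = idm (A ⊕ L).
  apply: (ax_jointly_epic (c := HD)).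
    by rewrite -compA jd tj comp1m.
  by rewrite -compA ld tl comp1m.
have t't : t^† ∘ t = idm M.
  apply: kE => n; apply: (ax_jointly_epic (c := HD)).
    by rewrite -!compA !jE tj jd comp1m.
  by rewrite -!compA -!lc (compA t) tl compA ld comp1m.
have t'c n : t^† ∘ (idm A ⊕₁ c n) = k n by rewrite -tk compA t't comp1m.
split=> // N h hc; have [w [wk wU]] := kU N h hc.
exists (w ∘ t^†); split=> [n|w' w'E]; first by rewrite -compA t'c.
rewrite (wU (w' ∘ t)); first by rewrite -compA tt' compm1.
by move=> n; rewrite -compA tk.
Qed.

End Colimits.

(** * Suprema as colimits *)

Section Suprema.
Context {D : dagger_rig_category} (HD : contraction_axioms D).
Local Notation I := (@one_ob D).
Local Notation C := (localisation HD).
Local Notation U := (loc_functor HD).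

(** The daggers of the morphisms witnessing that [y^†y] is an upper bound form
    a cocone, because [y] is generating. The induced map [w : L --> Y] has a
    dagger sending [y] to a vector with the same components as [s]. *)
Lemma Rsup_colimit (X : nat -> D) (f : forall n, hom (X n) (X n.+1))
    (L : D) (c : forall n, hom (X n) L)
    (x : forall n, @hom C I (X n)) (s : @hom C I L) :
  is_colimit f c -> (forall n, U (c n)^† ∘ s = x n) ->
  Rsup (fun n => normsq (x n)) (normsq s).
Proof.
move=> cL sx; have [cc cU] := cL; split=> [n|u].
  by apply/normsq_le; exists (c n)^†.
have [Y [y [gy ->]]] := normsq_generating u => ub.
pose h n := sval (cid ((normsq_le _ _).1 (ub n))).
have hE n : x n = U (h n) ∘ y := svalP (cid ((normsq_le _ _).1 (ub n))).
have [|w [wc _]] := cU Y (fun n => (h n)^†).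
  move=> n; rewrite -[f n]dagK -dagM; congr (_^†); apply: gy.
  rewrite loc_functorM -compA -!hE -!sx compA -loc_functorM -dagM.
  by rewrite (cc n).
apply/normsq_le; exists w^†.
apply: (loc_jointly_monic (colimit_jointly_epic cL)) => n.
by rewrite compA -loc_functorM -dagM wc dagK sx hE.
Qed.

(** With generating vectors, the morphisms [Y --> X n] that witness an upper
    bound are epic, hence their daggers are a cocone of monomorphisms. *)
Lemma bounded_increasing_colimit (b : nat -> Rplus HD) (u : Rplus HD) :
  Rincreasing b -> Rupper_bound b u ->
  exists (X : nat -> D) (f : forall n, hom (X n) (X n.+1))
      (L : D) (c : forall n, hom (X n) L)
      (x : forall n, @hom C I (X n)) (s : @hom C I L),
    [/\ bounded_sequence f, is_colimit f c, forall n, U (c n)^† ∘ s = x n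
      & forall n, b n = normsq (x n)].
Proof.
move=> inc ub.
pose X n := sval (cid (normsq_generating (b n))).
pose x n : @hom C I (X n) := sval (cid (svalP (cid (normsq_generating (b n))))).
have [gx bE] : (forall n, generating (x n)) /\ forall n, b n = normsq (x n).
  by split=> n; have [] := svalP (cid (svalP (cid (normsq_generating (b n))))).
have [Y [y [gy uE]]] := normsq_generating u.
have fP n : exists f : hom (X n.+1) (X n), x n = U f ∘ x n.+1.
  by apply/normsq_le; rewrite -!bE; apply: inc.
have gP n : exists g : hom Y (X n), x n = U g ∘ y.
  by apply/normsq_le; rewrite -bE -uE; apply: ub.
pose f n := sval (cid (fP n)); have fE n : x n = _ := svalP (cid (fP n)).
pose g n := sval (cid (gP n)); have gE n : x n = _ := svalP (cid (gP n)).
have gc : is_cocone (fun n => (f n)^†) (fun n => (g n)^†).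
  move=> n; rewrite -dagM; congr (_^†); apply: gy.
  by rewrite loc_functorM -compA -gE -fE.
have bs : bounded_sequence (fun n => (f n)^†).
  exists Y, (fun n => (g n)^†); split=> // n.
  apply: epic_dag_monic; apply: (generating_comp_epic (x := y)).
  by rewrite -gE.
have [L [c cL]] := ax_bounded_colimit HD bs.
have [w [wc _]] := cL.2 _ _ gc.
exists X, (fun n => (f n)^†), L, c, x, (U w^† ∘ y); split=> // n.
by rewrite compA -loc_functorM -dagM wc dagK.
Qed.

End Suprema.

(** The colimit computes one supremum [r], and [oplus_colimit] shows that
    [a + r] is the supremum of the sums; any other supremum [s] lies both
    below and above [r], which suffices by monotonicity of [a + -]. *)
Theorem proposition14 (D : dagger_rig_category) (HD : contraction_axioms D)
    (b : nat -> Rplus HD) :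
  Rincreasing b ->
  (exists u : Rplus HD, Rupper_bound b u) ->
  (exists s : Rplus HD, Rsup b s) /\
  (forall (a s : Rplus HD),
      Rsup b s -> Rsup (fun n : nat => Radd a (b n)) (Radd a s)).
Proof.
move=> inc [u ub].
have [X [f [L [c [x [r [bs cL rx bE]]]]]]] := bounded_increasing_colimit inc ub.
have rsup : Rsup b (normsq r).
  by rewrite (funext bE); apply: Rsup_colimit cL rx.
split; first by exists (normsq r).
move=> a s [sub sleast]; split=> [n|v vub].
  by apply: Radd_le; apply: sub.
have sr : Rle (Radd a s) (Radd a (normsq r)).
  by apply: Radd_le; apply: sleast; case: rsup.
apply: Rle_trans sr _.
have [A [α [_ aE]]] := normsq_generating a.
have zE n : Radd a (b n) = normsq (vpair α (x n)) by rewrite aE bE Radd_normsq.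
rewrite aE Radd_normsq.
have [|_] := Rsup_colimit (oplus_colimit HD A bs cL) (s := vpair α r)
  (x := fun n => vpair α (x n)).
  move=> n; rewrite oplus1_dag vpair_oplus rx dag1 loc_functor1.
  by rewrite comp1m.
by apply=> n; rewrite -zE.
Qed.
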